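(* Let $n\ge4$ be an integer and let $l\in\mathbb{N}$ satisfy $0<l<\tfrac n2$ and $l\ne\tfrac n3$. If the $l$-th eigenvalue pair is the only eigenvalue pair of the trivial equilibrium $x_F=(F,\dots,F)$ of the Lorenz-96 model crossing the imaginary axis at the parameter value $F_{\mathrm H}(l,n)=1/f(l,n)$, then $x_F$ exhibits a Hopf bifurcation at $F=F_{\mathrm H}(l,n)$. The first Lyapunov coefficient for this bifurcation is $$\ell_1(l,n)=\frac4n\tan\left(\tfrac{\pi l}{n}\right)\sin^2\left(\tfrac{3\pi l}{n}\right)\frac{5\cos(\tfrac{2\pi l}{n})+8\cos(\tfrac{4\pi l}{n})-2\cos(\tfrac{6\pi l}{n})-8}{4\cos(\tfrac{2\pi l}{n})-4\cos(\tfrac{4\pi l}{n})+9}.$$ Fix $y_0\in(0,\pi)$ such that $5\cos y_0+8\cos 2y_0-2\cos 3y_0-8=0$. Then $\ell_1(l,n)$ is - positive if $0<\tfrac ln<\tfrac{y_0}{2\pi}\approx 0.08825746$, which corresponds to a subcritical bifurcation; - negative if $\tfrac ln\in\left(\tfrac{y_0}{2\pi},\tfrac12\right)\setminus\{\tfrac13\}$, which corresponds to a supercritical bifurcation.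
   Context: The Lorenz-96 model of dimension $n$ with parameter $F\in\mathbb{R}$ is the system of ordinary differential equations $\dot x_j = x_{j-1}(x_{j+1}-x_{j-2})-x_j+F$, $j=1,\dots,n$, with indices taken modulo $n$. It has the trivial equilibrium $x_F=(F,\dots,F)$. Put $$f(j,n)=\cos\tfrac{2\pi j}{n}-\cos\tfrac{4\pi j}{n},\qquad g(j,n)=-\sin\tfrac{2\pi j}{n}-\sin\tfrac{4\pi j}{n}.$$ For $n\ge4$ the eigenvalues of the Jacobian matrix at $x_F$ are $\lambda_j(F,n)=-1+F f(j,n)+iF g(j,n)$, $j=0,\dots,n-1$, and $\lambda_{n-j}=\overline{\lambda_j}$ for $1\le j\le n-1$. The pair $\{\lambda_j,\lambda_{n-j}\}$ is called the $j$-th eigenvalue pair. The normalized eigenvector for $\lambda_j$ is $v_j=\tfrac{1}{\sqrt n}(1,\rho_j,\rho_j^2,\dots,\rho_j^{n-1})^\top$ with $\rho_j=e^{-2\pi i j/n}$. Hopf bifurcation: (a) a single nonzero purely imaginary eigenvalue pair crosses the imaginary axis with nonzero speed with respect to $F$ at $F=F_{\mathrm H}$, and (b) the first Lyapunov coefficient $\ell_1$ is nonzero at $F_{\mathrm H}$. The bifurcation is called supercritical if $\ell_1<0$ and subcritical if $\ell_1>0$. First Lyapunov coefficient: translate $x_F$ to the origin by $y_j=x_j-F$, so that the system reads $\dot y=Ay+\tfrac12B(y,y)$ with $A$ the Jacobian matrix at $x_F$ and $B$ the symmetric bilinear map with components $B_k(x,y)=x_{k-1}(y_{k+1}-y_{k-2})+y_{k-1}(x_{k+1}-x_{k-2})$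 (indices modulo $n$), extended complex-bilinearly; there are no cubic terms. At $F=F_{\mathrm H}(l,n)$ let $\pm i\omega_0$, $\omega_0>0$, be the imaginary eigenvalues, and let $q,p\in\mathbb{C}^n$ satisfy $Aq=i\omega_0q$, $A^\top p=-i\omega_0p$, normalized by $\langle q,q\rangle=\langle p,q\rangle=1$ (one takes $q=p=v_{n-l}$), where $\langle x,y\rangle=\sum_k\bar x_ky_k$. Then $$\ell_1=\frac{1}{2\omega_0}\mathrm{Re}\left[-2\langle p,B(q,A^{-1}B(q,\bar q))\rangle+\langle p,B(\bar q,(2i\omega_0I_n-A)^{-1}B(q,q))\rangle\right].$$ *)

(* Defs.v *)
From HB Require Import structures.
From mathcomp Require Import all_boot all_order all_algebra.
From mathcomp Require Import complex.
From mathcomp Require Import all_classical all_reals all_analysis.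

Set Implicit Arguments.
Unset Strict Implicit.
Unset Printing Implicit Defensive.

Import Order.TTheory GRing.Theory Num.Theory.
Import numFieldNormedType.Exports.

Local Open Scope classical_set_scope.
Local Open Scope complex_scope.
Local Open Scope ring_scope.

Section Lorenz96.
Context {R : realType}.

(* Coordinates are indexed by 'I_n = {0, ..., n-1} instead of {1, ..., n}; the
   cyclic shifts ordS and ord_pred are j |-> j+1 and j |-> j-1 modulo n. *)
Definition lorenz96 (n : nat) (F : R) (x : 'rV[R]_n) : 'rV[R]_n :=
  \row_j (x 0 (ord_pred j) * (x 0 (ordS j) - x 0 (ord_pred (ord_pred j)))
          - x 0 j + F).

Definition trivial_eq (n : nat) (F : R) : 'rV[R]_n := const_mx F.

Lemma trivial_eq_equilibrium (n : nat) (F : R) :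
  lorenz96 F (trivial_eq n F) = 0.
Proof. by apply/rowP => j; rewrite !mxE subrr mulr0 sub0r addNr. Qed.

(* The library Jacobian acts on row vectors from the right (its rows are
   indexed by the variables), whence the transposition: entry (k, j) below is
   the partial derivative of the k-th component with respect to x_j. *)
Definition jacobian_eq (n : nat) (F : R) : 'M[R]_n :=
  ('J (lorenz96 F) (trivial_eq n F))^T.

Definition jacobian_eqC (n : nat) (F : R) : 'M[R[i]]_n :=
  map_mx (real_complex R) (jacobian_eq n F).

Definition ang (k l n : nat) : R := k%:R * pi * l%:R / n%:R.

Definition feig (j n : nat) : R := cos (ang 2 j n) - cos (ang 4 j n).
Definition geig (j n : nat) : R := - sin (ang 2 j n) - sin (ang 4 j n).

Definition lambda (j n : nat) (F : R) : R[i] :=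
  (- 1 + F * feig j n) +i* (F * geig j n).

Definition F_H (l n : nat) : R := (feig l n)^-1.

Definition crosses_imaginary_axis (mu : R -> R[i]) (F0 : R) : Prop :=
  complex.Re (mu F0) = 0 /\
  (((\forall F \near F0^'-, complex.Re (mu F) < 0) /\
    (\forall F \near F0^'+, 0 < complex.Re (mu F))) \/
   ((\forall F \near F0^'-, 0 < complex.Re (mu F)) /\
    (\forall F \near F0^'+, complex.Re (mu F) < 0))).

Definition only_crossing_pair (n l : nat) (F0 : R) : Prop :=
  forall j : nat, (j < n)%N ->
    crosses_imaginary_axis (lambda j n) F0 <-> j = l \/ j = (n - l)%N.

(* At F0 the spectrum of A meets the imaginary axis exactly in a nonzero pair
   {i w, - i w} of simple eigenvalues, and the real part of the eigenvalue
   branch mu through i w has nonzero derivative at F0. As i w is simple, the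
   germ of mu at F0 is determined by these conditions; as A F is real, the
   branch through - i w is the conjugate of mu. *)
Definition imaginary_pair_crossing (n : nat) (A : R -> 'M[R[i]]_n) (F0 : R) :
    Prop :=
  exists2 w : R, 0 < w &
    [/\ forall z : R[i], eigenvalue (A F0) z /\ complex.Re z = 0 <->
                         z = 0 +i* w \/ z = 0 -i* w,
        mup (0 +i* w) (char_poly (A F0)) = 1%N,
        mup (0 -i* w) (char_poly (A F0)) = 1%N &
        exists mu : R -> R[i],
          [/\ mu F0 = 0 +i* w,
              \forall F \near F0, eigenvalue (A F) (mu F),
              derivable (fun F => complex.Re (mu F)) F0 1,
              derivable (fun F => complex.Im (mu F)) F0 1 &
              derive1 (fun F => complex.Re (mu F)) F0 != 0]].

Definition cdot (n : nat) (x y : 'cV[R[i]]_n) : R[i] :=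
  \sum_k (x k 0)^* * y k 0.

Definition conj_cV (n : nat) (x : 'cV[R[i]]_n) : 'cV[R[i]]_n :=
  map_mx (@conjc R) x.

Definition Bform (n : nat) (x y : 'cV[R[i]]_n) : 'cV[R[i]]_n :=
  \col_k (x (ord_pred k) 0 * (y (ordS k) 0 - y (ord_pred (ord_pred k)) 0)
        + y (ord_pred k) 0 * (x (ordS k) 0 - x (ord_pred (ord_pred k)) 0)).

Definition critical_eigenvectors (n : nat) (A : 'M[R[i]]_n) (w : R)
    (q p : 'cV[R[i]]_n) : Prop :=
  [/\ 0 < w, A *m q = (0 +i* w) *: q, A^T *m p = (0 -i* w) *: p,
      cdot q q = 1 & cdot p q = 1].

Definition lyapunov_formula (n : nat) (A : 'M[R[i]]_n) (w : R)
    (q p : 'cV[R[i]]_n) : R :=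
  (2 * w)^-1 *
  complex.Re (- 2 * cdot p (Bform q (invmx A *m Bform q (conj_cV q)))
    + cdot p (Bform (conj_cV q)
                (invmx ((0 +i* (2 * w))%:M - A) *m Bform q q))).

(* The formula is evaluated on arbitrary admissible w, q, p: the value a has to
   be independent of their choice, and there has to be at least one choice. *)
Definition first_lyapunov_coefficient (n : nat) (F0 a : R) : Prop :=
  let A := jacobian_eqC n F0 in
  (exists w q p, critical_eigenvectors A w q p) /\
  (forall w q p, critical_eigenvectors A w q p -> lyapunov_formula A w q p = a).

Definition hopf_bifurcation (n : nat) (F0 : R) : Prop :=
  imaginary_pair_crossing (jacobian_eqC n) F0 /\
  (exists2 a : R, first_lyapunov_coefficient n F0 a & a != 0).

Definition supercritical_hopf (n : nat) (F0 : R) : Prop :=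
  hopf_bifurcation n F0 /\
  (exists2 a : R, first_lyapunov_coefficient n F0 a & a < 0).

Definition subcritical_hopf (n : nat) (F0 : R) : Prop :=
  hopf_bifurcation n F0 /\
  (exists2 a : R, first_lyapunov_coefficient n F0 a & 0 < a).

Definition ell1 (l n : nat) : R :=
  4 / n%:R * tan (ang 1 l n) * sin (ang 3 l n) ^+ 2 *
  ((5 * cos (ang 2 l n) + 8 * cos (ang 4 l n) - 2 * cos (ang 6 l n) - 8) /
   (4 * cos (ang 2 l n) - 4 * cos (ang 4 l n) + 9)).

Definition is_y0 (y : R) : Prop :=
  [/\ 0 < y, y < pi &
      5 * cos y + 8 * cos (2 * y) - 2 * cos (3 * y) - 8 = 0].

(* 0.08825746, written in groups of digits to keep the numerals small. *)
Definition y0_ratio_approx : R :=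
  88 / 10 ^+ 3 + 257 / 10 ^+ 6 + 46 / 10 ^+ 8.

End Lorenz96.

(* Main.v *)
Require Import Defs.
From HB Require Import structures.
From mathcomp Require Import all_boot all_order all_algebra.
From mathcomp Require Import complex ring lra.
From mathcomp Require Import all_classical all_reals all_analysis.

Import Order.TTheory GRing.Theory Num.Theory.
Import numFieldNormedType.Exports.

Local Open Scope ring_scope.

(** Why the theorem holds.

    The Jacobian at the trivial equilibrium commutes with cyclic shifts, so the
    plane waves (w ^ k)_k with w ^ n = 1 diagonalize it simultaneously for every
    F ([jacobian_eqC_wave], [jacobian_fourier]), with eigenvalues
    -1 + F (w - w^-2), which are the numbers lambda_j ([symbol_zeta]).  The
    characteristic polynomial, the spectrum, the simplicity of eigenvalues and
    all eigenvectors are read off from this diagonalization.  Every lambda_j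
    whose real part vanishes at some F crosses the axis there, since
    F |-> Re lambda_j is affine with value -1 at 0; the hypothesis therefore
    says that at F_H the imaginary axis meets the spectrum exactly in lambda_l
    and lambda_(n-l), which are -i omega and i omega with
    omega = sin t / (1 - cos t) and t = 2 pi l / n ([lambda_imaginary],
    [lambda_l], [lambda_opp]).  This is the crossing condition, and it makes A
    and 2 i omega - A invertible.

    The bilinear map B sends a pair of plane waves to a multiple of the plane
    wave of the product ([Bform_wave]), so each vector in the Lyapunov formula
    is a multiple of a plane wave and each inverse matrix acts on it as a
    scalar.  The coefficient becomes an explicit rational function of
    z = exp(i t) ([lyapunov_formula_wave]), whose real part simplifies
    ([Re_lyapunov_bracket]) to a positive factor times
    P (cos t), where P(c) = -8 c^3 + 16 c^2 + 11 c - 16 ([ell1E]).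

    P has exactly one root in [-1, 1]: it is negative up to 8/10 and increasing
    from there to 1.  As cos decreases on [0, pi], P (cos y) is positive before
    y0 and negative after it.  The decimals of y0 / (2 pi) come from truncated
    cosine series ([cos_horner_alternating]), first for pi and then for
    cos at the two ends of the claimed interval.

    A Hopf bifurcation also needs a nonzero coefficient, that is, y0 / (2 pi)
    must be irrational ([lyap_cubic_rational_angle_neq0]).  If t is a rational
    multiple of pi then 2 cos t is an algebraic integer, and P (cos t) = 0 then
    forces cos t itself to be one.  Among rational angles this only happens for
    cos t = 0, 1, -1 ([integral_cos_rational_angle]), and none of these is a
    root of P. *)

(** * Rational bounds for the cosine and for pi *)

Section CosineNumerics.
Local Open Scope classical_set_scope.
Local Open Scope ring_scope.
Context {R : realType}.
Implicit Types x y : R.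

(** Horner form of a truncated cosine series in the variable y = x^2; the offset m
    makes the tail of the series an instance of the same function, and the nested
    quotients avoid large factorials. *)
Fixpoint cos_horner (n m : nat) y : R :=
  if n is k.+1 then 1 - y / (m.+1 * m.+2)%:R * cos_horner k m.+2 y else 0.

Lemma cos_horner_sum n m y :
  cos_horner n m y =
  \sum_(0 <= i < n) (-1) ^+ i * y ^+ i * (m`!%:R / (m + i.*2)`!%:R).
Proof.
elim: n m => [|n IHn] m /=; first by rewrite big_nil.
have fact_neq0 k : k`!%:R != 0 :> R by rewrite pnatr_eq0 -lt0n fact_gt0.
rewrite big_nat_recl// double0 addn0 divff// !expr0 !mulr1; congr (_ + _).
rewrite IHn mulr_sumr -sumrN; apply: eq_bigr => i _.
have -> : (m + i.+1.*2 = m.+2 + i.*2)%N by rewrite doubleS !addnS !addSn.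
move: ((m.+2 + i.*2)`!%:R : R) (fact_neq0 (m.+2 + i.*2)%N) => a a0.
rewrite (factS m.+1) (factS m) !natrM !exprS.
have c0 : m.+1%:R != 0 :> R by rewrite pnatr_eq0.
have d0 : m.+2%:R != 0 :> R by rewrite pnatr_eq0.
move: (m`!%:R : R) (m.+1%:R : R) (m.+2%:R : R) c0 d0 => b c d c0 d0; field.
by rewrite a0 d0.
Qed.

(** The terms x^(2k) / (2k)! decrease for k > 0 as soon as x^2 <= 4, because the
    quotient of consecutive terms is x^2 / ((2k+1)(2k+2)). *)
Lemma cos_coeff_pair k x : 0 < x <= 2 -> (0 < k)%N ->
  0 < (-1) ^+ k * (cos_coeff' x k + cos_coeff' x k.+1).
Proof.
move=> /andP[x0 x2] k0; rewrite /cos_coeff' -!exprnP doubleS.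
have F0 : 0 < k.*2`!%:R :> R by rewrite ltr0n fact_gt0.
have -> : (-1) ^+ k * ((-1) ^+ k * x ^+ k.*2 / k.*2`!%:R +
    (-1) ^+ k.+1 * x ^+ k.*2.+2 / k.*2.+2`!%:R) =
  x ^+ k.*2 / k.*2`!%:R * (1 - x ^+ 2 / (k.*2.+1 * k.*2.+2)%:R).
  have s1 : (-1) ^+ k * (-1) ^+ k = 1 :> R by rewrite -exprMn mulrNN mulr1 expr1n.
  rewrite (factS k.*2.+1) (factS k.*2) !natrM.
  rewrite (exprS _ k) (exprS x k.*2.+1) (exprS x k.*2).
  have c0 : k.*2.+1%:R != 0 :> R by rewrite pnatr_eq0.
  have d0 : k.*2.+2%:R != 0 :> R by rewrite pnatr_eq0.
  move: (k.*2`!%:R : R) (k.*2.+1%:R : R) (k.*2.+2%:R : R) (gt_eqF F0) c0 d0 s1.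
  move: ((-1) ^+ k) (x ^+ k.*2) => s z a c d /negbT a0 c0 d0 s1.
  transitivity ((s * s) * (z / a * (1 - x ^+ 2 / (c * d)))); last by rewrite s1 mul1r.
  by field; rewrite c0 d0.
rewrite mulr_gt0 ?divr_gt0 ?exprn_gt0//.
rewrite subr_gt0 ltr_pdivrMr ?ltr0n// mul1r.
apply: (@le_lt_trans _ _ 4%:R); first by nra.
rewrite ltr_nat; case: k k0 {F0} => // k _.
exact: (@leq_trans (3 * 4)%N) (leq_mul _ _).
Qed.

(** Leibniz criterion: grouping the remainder of the series in consecutive pairs,
    every pair has the sign of its first term. *)
Lemma cos_horner_alternating n x : 0 < x <= 2 -> (0 < n)%N ->
  0 < (-1) ^+ n * (cos x - cos_horner n 0 (x ^+ 2)).
Proof.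
move=> x02 n0; rewrite mulrBr subr_gt0 cos_horner_sum.
have cc : series (fun i => (-1) ^+ n * cos_coeff' x i) @ \oo -->
    (-1) ^+ n * cos x.
  rewrite (_ : series _ = fun k => (-1) ^+ n * series (cos_coeff' x) k).
    by apply: cvgMr; exact: cvg_cos_coeff'.
  by apply/funext => k; rewrite /series/= mulr_sumr.
rewrite -(cvg_lim (@Rhausdorff R) cc).
have -> : (-1) ^+ n * (\sum_(0 <= i < n)
    (-1) ^+ i * (x ^+ 2) ^+ i * (0`!%:R / (0 + i.*2)`!%:R)) =
    \sum_(0 <= i < n) (-1) ^+ n * cos_coeff' x i.
  rewrite mulr_sumr; apply: eq_bigr => i _; congr (_ * _).
  by rewrite /cos_coeff' add0n -exprM mul2n fact0 mul1r.
apply: lt_sum_lim_series; first by apply/cvg_ex; eexists; exact: cc.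
move=> d; rewrite -mulrDr addnS.
have := cos_coeff_pair (n + d.*2) x x02; rewrite addn_gt0 n0 => /(_ isT).
by rewrite exprD -[d.*2]mul2n (exprM _ 2 d) sqrrN !expr1n mulr1.
Qed.

Lemma cos_horner_lt n x : 0 < x <= 2 ->
  cos_horner n.+1.*2 0 (x ^+ 2) < cos x.
Proof.
move=> x02; have := cos_horner_alternating n.+1.*2 x x02.
by rewrite -mul2n exprM sqrrN !expr1n mul1r subr_gt0; apply.
Qed.

Lemma lt_cos_horner n x : 0 < x <= 2 ->
  cos x < cos_horner n.*2.+1 0 (x ^+ 2).
Proof.
move=> x02; have := cos_horner_alternating n.*2.+1 x x02.
by rewrite exprS -mul2n exprM sqrrN !expr1n mulr1 mulN1r oppr_gt0 subr_lt0; apply.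
Qed.

(** pi / 2 is the zero of cos in [0, 2], so the signs of cos at two rational points
    enclose it; the truncations are exact enough to settle these signs. *)
Lemma pi_bounds : 3 + 141 / 10 ^+ 3 + 592 / 10 ^+ 6 + 653 / 10 ^+ 9 < (pi : R) <
                  3 + 141 / 10 ^+ 3 + 592 / 10 ^+ 6 + 654 / 10 ^+ 9.
Proof.
have pi2 := @pi_ge2 R; have pi4 := @pihalf_lt2 R; have pi0 := @pi_gt0 R.
set a := (X in X < _ < _); set b := (X in _ < _ < X).
have pihalf_in : pi / 2 \in `[0, (pi : R)] by rewrite in_itv/=; apply/andP; lra.
(* cos is larger than 1e-10 in absolute value at a / 2 and b / 2, whereas ten
   or eleven terms of its series leave an error below 1e-14. *)
have ca : 0 < cos (a / 2).
  apply: lt_trans (cos_horner_lt 4 (a / 2) _); last by rewrite /a; lra.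
  by rewrite /a -[(4.+1).*2]/10%N /cos_horner; lra.
have cb : cos (b / 2) < 0.
  apply: lt_trans (lt_cos_horner 5 (b / 2) _) _; first by rewrite /b; lra.
  by rewrite /b -[(5.*2).+1]/11%N /cos_horner; lra.
apply/andP; split; rewrite ltNge; apply/negP => h.
- have : cos (a / 2) <= cos (pi / 2).
    rewrite leNgt ltr_cos//; first by rewrite -leNgt; lra.
    by rewrite in_itv/=; apply/andP; rewrite /a; lra.
  by rewrite cos_pihalf; lra.
- have : cos (pi / 2) <= cos (b / 2).
    rewrite leNgt ltr_cos//; first by rewrite -leNgt; lra.
    by rewrite in_itv/=; apply/andP; rewrite /b; lra.
  by rewrite cos_pihalf; lra.
Qed.

End CosineNumerics.

(** * The cubic that carries the sign, and its root *)

Section LyapunovCubic.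
Local Open Scope classical_set_scope.
Local Open Scope ring_scope.
Context {R : realType}.
Implicit Types c y : R.

Definition lyap_cubic c : R := - 8 * c ^+ 3 + 16 * c ^+ 2 + 11 * c - 16.

Lemma cos2x y : cos (2 * y) = 2 * cos y ^+ 2 - 1.
Proof. by rewrite [2 * y]mulr_natl cos_mulr2n; ring. Qed.

Lemma sin2x y : sin (2 * y) = 2 * sin y * cos y.
Proof. by rewrite [2 * y]mulr_natl sin_mulr2n; ring. Qed.

Lemma cos3x y : cos (3 * y) = 4 * cos y ^+ 3 - 3 * cos y.
Proof.
have -> : 3 * y = 2 * y + y by ring.
rewrite cosD cos2x sin2x; have := cos2Dsin2 y.
move: (cos y) (sin y) => c s /eqP; rewrite addrC eq_sym -subr_eq => /eqP s2.
have -> : 2 * s * c * s = 2 * c * s ^+ 2 by ring.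
by rewrite -s2; ring.
Qed.

Lemma cosine_lyap_cubic y :
  5 * cos y + 8 * cos (2 * y) - 2 * cos (3 * y) - 8 = lyap_cubic (cos y).
Proof. by rewrite cos2x cos3x /lyap_cubic; ring. Qed.

(** On this interval the cubic decreases and then increases, so its sign is settled by
    direct estimates: c^2 <= 8/10 c for c >= 0 and c^2 <= -c for c <= 0. *)
Lemma lyap_cubic_lt0 c : -1 <= c <= 8 / 10 -> lyap_cubic c < 0.
Proof.
move=> /andP[c1 c2]; rewrite /lyap_cubic; have [c0|c0] := leP 0 c.
  have h : c ^+ 2 <= 8 / 10 * c by nra.
  have h3 : 0 <= (8 / 10 - c) * c ^+ 2 by rewrite mulr_ge0 ?sqr_ge0//; lra.
  have h4 : 0 <= c * (c - 8/10) ^+ 2 by rewrite mulr_ge0 ?sqr_ge0//; lra.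
  nra.
have h : c ^+ 2 <= - c by nra.
have h3 : 0 <= (1 + c) * c ^+ 2 by rewrite mulr_ge0 ?sqr_ge0//; lra.
nra.
Qed.

(** The difference quotient of the cubic is 16(c+d) + 11 - 8(c^2 + cd + d^2), which
    is positive when c and d lie in [8/10, 1]. *)
Lemma lyap_cubic_mono c d : 8 / 10 <= c -> c < d -> d <= 1 ->
  lyap_cubic c < lyap_cubic d.
Proof.
move=> c8 cd d1; rewrite -subr_gt0 /lyap_cubic.
have -> : - 8 * d ^+ 3 + 16 * d ^+ 2 + 11 * d - 16 -
    (- 8 * c ^+ 3 + 16 * c ^+ 2 + 11 * c - 16) =
  (d - c) * (16 * (c + d) + 11 - 8 * (c ^+ 2 + c * d + d ^+ 2)) by ring.
apply: mulr_gt0; first by rewrite subr_gt0.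
nra.
Qed.

Lemma lyap_cubic_root_gt c : -1 <= c -> lyap_cubic c = 0 -> 8 / 10 < c.
Proof.
by move=> c1 c0; rewrite ltNge; apply/negP => c8; have := lyap_cubic_lt0 c;
   rewrite c1 c8 c0 ltxx => /(_ isT).
Qed.

Lemma lyap_cubic_below c0 c : -1 <= c0 <= 1 -> lyap_cubic c0 = 0 ->
  -1 <= c < c0 -> lyap_cubic c < 0.
Proof.
move=> /andP[l0 u0] r0 /andP[l u]; have [c8|c8] := leP c (8 / 10).
  by apply: lyap_cubic_lt0; rewrite l.
by rewrite -r0; apply: lyap_cubic_mono => //; exact: ltW.
Qed.

Lemma lyap_cubic_above c0 c : -1 <= c0 <= 1 -> lyap_cubic c0 = 0 ->
  c0 < c <= 1 -> 0 < lyap_cubic c.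
Proof.
move=> /andP[l0 u0] r0 /andP[l u]; rewrite -r0; apply: lyap_cubic_mono => //.
exact/ltW/lyap_cubic_root_gt.
Qed.

Lemma is_y0P y : is_y0 y <-> [/\ 0 < y, y < pi & lyap_cubic (cos y) = 0].
Proof. by rewrite -cosine_lyap_cubic. Qed.

Lemma exists_y0 : exists y0 : R, is_y0 y0.
Proof.
have : {within `[0, pi], continuous (fun y : R => lyap_cubic (cos y))}.
  apply: continuous_subspaceT => y.
  pose p : {poly R} := (-8)%:P * 'X ^+ 3 + 16%:P * 'X ^+ 2 + 11%:P * 'X - 16%:P.
  rewrite (_ : (fun y => _) = horner p \o cos); last first.
    by apply/funext => z; rewrite /lyap_cubic /p /= !hornerE.
  by apply: continuous_comp; [exact: continuous_cos|exact: continuous_horner].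
move=> /(@IVT R _ 0 pi 0 (@pi_ge0 R)).
rewrite cos0 cospi => /(_ _)[|y].
  by rewrite /lyap_cubic ge_min le_max; apply/andP; split; apply/orP; [right|left]; lra.
rewrite in_itv/= => /andP[y0 ypi] ry; exists y; apply/is_y0P; split => //.
  rewrite lt_neqAle y0 andbT; apply/eqP => y_0; move: ry.
  by rewrite -y_0 cos0 /lyap_cubic; lra.
rewrite lt_neqAle ypi andbT; apply/eqP => y_pi; move: ry.
by rewrite y_pi cospi /lyap_cubic; lra.
Qed.

Lemma lyap_cubic_cos_gt0 y0 y : is_y0 y0 -> 0 <= y < y0 ->
  0 < lyap_cubic (cos y).
Proof.
move=> /is_y0P[y0_gt0 y0_ltpi ry] /andP[y_ge0 yy0].
apply: (lyap_cubic_above (cos y0)) => //; first by rewrite cos_geN1 cos_le1.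
rewrite cos_le1 ltr_cos ?yy0// in_itv/= ?y_ge0 ?(ltW y0_gt0)/= ltW//.
exact: lt_trans y0_ltpi.
Qed.

Lemma lyap_cubic_cos_lt0 y0 y : is_y0 y0 -> y0 < y <= pi ->
  lyap_cubic (cos y) < 0.
Proof.
move=> /is_y0P[y0_gt0 y0_ltpi ry] /andP[yy0 y_lepi].
apply: (lyap_cubic_below (cos y0)) => //; first by rewrite cos_geN1 cos_le1.
rewrite cos_geN1 ltr_cos ?yy0// in_itv/= ?y_lepi ?(ltW y0_ltpi) ?andbT ltW//.
exact: lt_trans yy0.
Qed.

(** The angle u bounds from above the angle 2 pi (a - 5e-9), with a the announced
    value of y0 / (2 pi), because the first factor exceeds 2 pi.  The number r separates
    cos u from the root of the cubic. *)
Lemma lyap_cubic_cos_lower (u : R) :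
  u = 2 * (3 + 141 / 10 ^+ 3 + 592 / 10 ^+ 6 + 654 / 10 ^+ 9) *
      (88 / 10 ^+ 3 + 257 / 10 ^+ 6 + 455 / 10 ^+ 9) ->
  0 < lyap_cubic (cos u).
Proof.
move=> uE; pose r : R := 850 / 10 ^+ 3 + 143 / 10 ^+ 6 + 822 / 10 ^+ 9.
apply: (@lt_trans _ _ (lyap_cubic r)); first by rewrite /lyap_cubic /r; lra.
apply: lyap_cubic_mono; [by rewrite /r; lra| |exact: cos_le1].
apply: lt_trans (cos_horner_lt 3 u _); last by rewrite uE; lra.
by rewrite /r uE -[(3.+1).*2]/8%N /cos_horner; lra.
Qed.

(** Counterpart of [lyap_cubic_cos_lower] for the upper end of the interval: v is below
    2 pi (a + 5e-9). *)
Lemma lyap_cubic_cos_upper (v : R) :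
  v = 2 * (3 + 141 / 10 ^+ 3 + 592 / 10 ^+ 6 + 653 / 10 ^+ 9) *
      (88 / 10 ^+ 3 + 257 / 10 ^+ 6 + 465 / 10 ^+ 9) ->
  lyap_cubic (cos v) < 0.
Proof.
move=> vE; pose r : R := 850 / 10 ^+ 3 + 143 / 10 ^+ 6 + 818 / 10 ^+ 9.
have [v8|v8] := leP (cos v) (8 / 10).
  by apply: lyap_cubic_lt0; rewrite cos_geN1.
apply: (@lt_trans _ _ (lyap_cubic r)); last by rewrite /lyap_cubic /r; lra.
apply: lyap_cubic_mono; [exact: ltW| |by rewrite /r; lra].
apply: lt_trans (lt_cos_horner 4 v _) _; first by rewrite vE; lra.
by rewrite /r vE -[(4.*2).+1]/9%N /cos_horner; lra.
Qed.

Lemma y0_ratio_bound (y0 : R) : is_y0 y0 ->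
  `|y0 / (2 * pi) - y0_ratio_approx| < 5 / 10 ^+ 9.
Proof.
move=> y0P; have [y0_gt0 y0_ltpi ry] := (is_y0P _).1 y0P.
have /andP[pl pu] := @pi_bounds R.
rewrite ltr_distl ltr_pdivlMr ?ltr_pdivrMr ?mulr_gt0 ?pi_gt0//.
rewrite /y0_ratio_approx; apply/andP; split.
- set u : R := 2 * (3 + 141 / 10 ^+ 3 + 592 / 10 ^+ 6 + 654 / 10 ^+ 9) *
    (88 / 10 ^+ 3 + 257 / 10 ^+ 6 + 455 / 10 ^+ 9).
  apply: (@lt_trans _ _ u); first by clear ry; rewrite /u; lra.
  rewrite ltNge le_eqVlt; apply/negP => /predU1P[yu|yu].
    by have := lyap_cubic_cos_lower u erefl; rewrite -yu ry ltxx.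
  have := lyap_cubic_cos_lower u erefl; rewrite ltNge => /negP; apply.
  apply/ltW/(lyap_cubic_cos_lt0 y0) => //; rewrite yu /u; clear ry yu; lra.
- set v : R := 2 * (3 + 141 / 10 ^+ 3 + 592 / 10 ^+ 6 + 653 / 10 ^+ 9) *
    (88 / 10 ^+ 3 + 257 / 10 ^+ 6 + 465 / 10 ^+ 9).
  apply: (@lt_trans _ _ v); last by clear ry; rewrite /v; lra.
  rewrite ltNge le_eqVlt; apply/negP => /predU1P[yv|yv].
    by have := lyap_cubic_cos_upper v erefl; rewrite yv ry ltxx.
  have := lyap_cubic_cos_upper v erefl; rewrite ltNge => /negP; apply.
  apply/ltW/(lyap_cubic_cos_gt0 y0) => //; rewrite yv /v; clear ry yv; lra.
Qed.

End LyapunovCubic.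

(** * The Jacobian at the trivial equilibrium *)

Section Jacobian.
Context {R : realType}.

(** Each component of the vector field is a polynomial in the coordinates, so its
    derivative follows from this one by the rules of calculus. *)
Lemma is_derive_coord n (x v : 'rV[R]_n) (k : 'I_n) :
  is_derive x v (fun y : 'rV[R]_n => y 0 k : R) (v 0 k).
Proof.
have dk : differentiable (fun y : 'rV[R]_n => y 0 k : R) x.
  exact: differentiable_coord.
apply: DeriveDef; first exact: diff_derivable.
have dx : derivable (id : 'rV[R]_n -> 'rV[R]_n) x v by exact: derivable_id.
by have := derive_mx dx; rewrite derive_id => /rowP/(_ k); rewrite !mxE.
Qed.

Lemma differentiable_lorenz96 n (F : R) (x : 'rV[R]_n) :
  differentiable (lorenz96 F) x.
Proof.
have -> : @lorenz96 R n F = \sum_(j < n) (fun y : 'rV[R]_n =>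
    (y 0 (ord_pred j) * (y 0 (ordS j) - y 0 (ord_pred (ord_pred j)))
      - y 0 j + F) *: (delta_mx 0 j : 'rV[R]_n)).
  apply/funext => y; rewrite fct_sumE [LHS]row_sum_delta.
  by apply: eq_bigr => j _; rewrite mxE.
apply: differentiable_sum => j; apply: differentiableZl.
apply: differentiableD; last exact: differentiable_cst.
apply: differentiableB; last exact: differentiable_coord.
apply: differentiableM; first exact: differentiable_coord.
by apply: differentiableB; exact: differentiable_coord.
Qed.

(** The rows of the Jacobian are directional derivatives along the coordinate
    vectors, and these can be computed one component at a time. *)
Lemma jacobian_eqE n (F : R) (k j : 'I_n) :
  jacobian_eq n F k j =
  F * ((ordS k == j)%:R - (ord_pred (ord_pred k) == j)%:R) - (k == j)%:R.
Proof.
rewrite /jacobian_eq mxE.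
have df := @differentiable_lorenz96 n F (trivial_eq n F).
have -> : jacobian (lorenz96 F) (trivial_eq n F) j k =
    ('D_(delta_mx 0 j) (lorenz96 F) (trivial_eq n F)) 0 k.
  by rewrite deriveEjacobian// -rowE [RHS]mxE.
rewrite derive_mx; last exact: diff_derivable.
rewrite mxE; set v := delta_mx 0 j; set x := trivial_eq n F.
rewrite (_ : (fun y => _) = fun y : 'rV[R]_n =>
    y 0 (ord_pred k) * (y 0 (ordS k) - y 0 (ord_pred (ord_pred k)))
      - y 0 k + F); last by apply/funext => y; rewrite mxE.
have d1 := is_derive_coord n x v (ord_pred k).
have d2 := is_derive_coord n x v (ordS k).
have d3 := is_derive_coord n x v (ord_pred (ord_pred k)).
have d4 := is_derive_coord n x v k.
by rewrite derive_val /v /x !mxE !eqxx /= subrr scale0r !addr0.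
Qed.

End Jacobian.

(** * Plane waves *)

Section PlaneWaves.
Local Open Scope complex_scope.
Local Open Scope ring_scope.
Context {R : realType}.
Local Notation C := R[i].
Implicit Types (u v w : C) (F : R).

Definition wave n w : 'cV[C]_n := \col_k w ^+ k.

(** Fourier multiplier of the Jacobian on the plane wave with ratio w. *)
Definition symbol F w : C := - 1 + F%:C * (w - w ^- 2).

(** Multiplier of the bilinear part on a pair of plane waves. *)
Definition bsymbol u v : C := u^-1 * (v - v ^- 2) + v^-1 * (u - u ^- 2).

Lemma unity_neq0 n w (k : 'I_n) : w ^+ n = 1 -> w != 0.
Proof.
move=> wn; apply/eqP => w0; have := wn; rewrite w0 expr0n.
by case: n k {wn} => [[]//|n _] /= /esym/eqP; rewrite oner_eq0.
Qed.

Lemma wave_ordS n w (k : 'I_n) : w ^+ n = 1 ->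
  wave n w (ordS k) 0 = w * wave n w k 0.
Proof. by move=> wn; rewrite !mxE -exprS /= expr_mod. Qed.

Lemma wave_ord_pred n w (k : 'I_n) : w ^+ n = 1 ->
  wave n w (ord_pred k) 0 = w^-1 * wave n w k 0.
Proof.
move=> wn; rewrite -[in RHS](ord_predK k) wave_ordS// mulKf//.
exact: unity_neq0 wn.
Qed.

Lemma jacobian_eqC_mul n F (x : 'cV[C]_n) (k : 'I_n) :
  (jacobian_eqC n F *m x) k 0 =
  F%:C * (x (ordS k) 0 - x (ord_pred (ord_pred k)) 0) - x k 0.
Proof.
have pick (a : 'I_n) : \sum_j (a == j)%:R * x j 0 = x a 0.
  rewrite (bigD1 a)//= eqxx mul1r big1 ?addr0// => j /negbTE.
  by rewrite eq_sym => ->; rewrite mul0r.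
rewrite mxE -(pick (ordS k)) -(pick (ord_pred (ord_pred k))) -(pick k).
rewrite -sumrB mulr_sumr -sumrB; apply: eq_bigr => j _.
by rewrite mxE jacobian_eqE rmorphB rmorphM rmorphB/= !rmorph_nat; ring.
Qed.

Lemma jacobian_eqC_tr_mul n F (x : 'cV[C]_n) (k : 'I_n) :
  ((jacobian_eqC n F)^T *m x) k 0 =
  F%:C * (x (ord_pred k) 0 - x (ordS (ordS k)) 0) - x k 0.
Proof.
have pick (a : 'I_n) : \sum_j (j == a)%:R * x j 0 = x a 0.
  by rewrite (bigD1 a)//= eqxx mul1r big1 ?addr0// => j /negbTE ->; rewrite mul0r.
rewrite mxE -(pick (ordS (ordS k))) -(pick (ord_pred k)) -(pick k).
rewrite -sumrB mulr_sumr -sumrB; apply: eq_bigr => j _.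
rewrite mxE [X in X * _]mxE jacobian_eqE rmorphB rmorphM rmorphB/= !rmorph_nat.
have -> : (ordS j == k) = (j == ord_pred k).
  by rewrite (can2_eq (@ordSK n) (@ord_predK n)).
have -> : (ord_pred (ord_pred j) == k) = (j == ordS (ordS k)).
  by rewrite !(can2_eq (@ord_predK n) (@ordSK n)).
by ring.
Qed.

Lemma jacobian_eqC_wave n F w : w ^+ n = 1 ->
  jacobian_eqC n F *m wave n w = symbol F w *: wave n w.
Proof.
move=> wn; apply/colP => k; rewrite jacobian_eqC_mul [RHS]mxE.
rewrite wave_ordS// !wave_ord_pred// /symbol -exprVn.
by move: (wave n w k 0) => z; ring.
Qed.

(** Transposing a shift-invariant matrix reverses the shifts, that is, replaces w by
    its inverse. *)
Lemma jacobian_eqC_tr_wave n F w : w ^+ n = 1 ->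
  (jacobian_eqC n F)^T *m wave n w = symbol F w^-1 *: wave n w.
Proof.
move=> wn; apply/colP => k; rewrite jacobian_eqC_tr_mul [RHS]mxE.
rewrite !wave_ordS// !wave_ord_pred// /symbol -exprVn invrK.
by move: (wave n w k 0) => z; ring.
Qed.

Lemma Bform_scale n a b (x y : 'cV[C]_n) :
  Bform (a *: x) (b *: y) = (a * b) *: Bform x y.
Proof. by apply/colP => k; rewrite !mxE; ring. Qed.

Lemma Bform_wave n u v : u ^+ n = 1 -> v ^+ n = 1 ->
  Bform (wave n u) (wave n v) = bsymbol u v *: wave n (u * v).
Proof.
move=> un vn; apply/colP => k; rewrite mxE [RHS]mxE !wave_ordS// !wave_ord_pred//.
have -> : wave n (u * v) k 0 = wave n u k 0 * wave n v k 0.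
  by rewrite !mxE exprMn.
rewrite /bsymbol -!exprVn; move: (wave n u k 0) (wave n v k 0) => x y; ring.
Qed.

(** The inner product uses the conjugation of numeric closed fields, which coincides
    with the concrete one for which the rewriting rules are stated. *)
Lemma num_conjE (z : C) : Num.conj z = conjc z.
Proof. by []. Qed.

Lemma cdot_scale n a b (x y : 'cV[C]_n) :
  cdot (a *: x) (b *: y) = conjc a * b * cdot x y.
Proof.
rewrite /cdot mulr_sumr; apply: eq_bigr => k _.
by rewrite !mxE !num_conjE rmorphM/=; ring.
Qed.

Lemma cdot_wave n w : conjc w = w^-1 -> w != 0 ->
  cdot (wave n w) (wave n w) = n%:R.
Proof.
move=> cw w0; rewrite /cdot -[n in RHS]card_ord -sumr_const.
apply: eq_bigr => k _.
by rewrite !mxE num_conjE rmorphXn/= cw -exprMn mulVf// expr1n.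
Qed.

Lemma conj_cV_wave n a w : conjc w = w^-1 ->
  conj_cV (a *: wave n w) = conjc a *: wave n w^-1.
Proof. by move=> cw; apply/colP => k; rewrite !mxE rmorphM rmorphXn/= cw. Qed.

End PlaneWaves.

(** * Spectral data of a diagonalized matrix *)

Section Diagonalization.
Context {K : fieldType} (n : nat) (M V : 'M[K]_n) (d : 'rV[K]_n).
Hypotheses (MV : M *m V = V *m diag_mx d) (V_unit : V \in unitmx).

(** Invertibility of V over the field passes to polynomial matrices, where det V can
    be cancelled after comparing (X - M) V with V (X - D). *)
Lemma char_poly_diagonalization : char_poly M = \prod_j ('X - (d 0 j)%:P).
Proof.
have -> : \prod_j ('X - (d 0 j)%:P) = \prod_j ('X - (diag_mx d j j)%:P).
  by apply: eq_bigr => j _; rewrite mxE eqxx mulr1n.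
rewrite -char_poly_trig ?diag_mx_is_trig//.
have dV : \det (map_mx polyC V) != 0.
  by rewrite det_map_mx polyC_eq0 -unitfE -unitmxE.
apply: (mulIf dV); rewrite [RHS]mulrC /char_poly -!det_mulmx; congr (\det _).
rewrite /char_poly_mx mulmxBl mulmxBr -!map_mxM MV.
by rewrite scalar_mxC.
Qed.

Lemma unitmx_diagonalization : (forall j, d 0 j != 0) -> M \in unitmx.
Proof.
move=> d0; have : \det M * \det V = \det V * \prod_j d 0 j.
  by rewrite -det_mulmx MV det_mulmx det_diag.
rewrite mulrC => /(mulfI _) dM.
rewrite unitmxE dM; first by rewrite unitfE; apply/prodf_neq0 => j _.
by rewrite -unitfE -unitmxE.
Qed.

(** In the basis V the eigenvector equation decouples into (d_j - mu) y_j = 0. *)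
Lemma eigenvector_diagonalization mu (x : 'cV[K]_n) : M *m x = mu *: x ->
  exists2 y : 'cV[K]_n, x = V *m y & forall j, d 0 j != mu -> y j 0 = 0.
Proof.
move=> Mx; exists (invmx V *m x); first by rewrite mulKVmx.
move=> j dj; have : diag_mx d *m (invmx V *m x) = mu *: (invmx V *m x).
  apply: (can_inj (mulKmx V_unit)).
  by rewrite mulmxA -MV -mulmxA mulKVmx// -scalemxAr mulKVmx.
move=> /colP/(_ j); rewrite mul_diag_mx !mxE.
move/eqP; rewrite -subr_eq0 -mulrBl mulf_eq0 subr_eq0 (negbTE dj)/=.
by move=> /eqP.
Qed.

(** An eigenvalue that occurs once on the diagonal has a one-dimensional eigenspace. *)
Lemma eigenvector_line mu (x : 'cV[K]_n) j0 : M *m x = mu *: x ->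
  (forall j, d 0 j = mu -> j = j0) -> exists c, x = c *: col j0 V.
Proof.
move=> /eigenvector_diagonalization[y -> y0] dj; exists (y j0 0).
rewrite colE scalemxAr; congr (V *m _); apply/colP => j.
rewrite mxE [X in _ * X]mxE eqxx andbT; have [->|jj0] := eqVneq j j0.
  by rewrite mulr1.
by rewrite mulr0 y0//; apply: contraNneq jj0 => /dj ->.
Qed.

Lemma eigenvalue_in_diagonal mu (x : 'cV[K]_n) : M *m x = mu *: x -> x != 0 ->
  exists j, d 0 j = mu.
Proof.
move=> /eigenvector_diagonalization[y xy y0] x0.
apply: contrapT => nd; move/eqP: x0; apply.
rewrite xy (_ : y = 0) ?mulmx0//; apply/colP => j.
by rewrite y0 ?mxE//; apply/eqP => e; apply: nd; exists j.
Qed.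

Lemma eigenvalue_diagonalization mu :
  reflect (exists j, d 0 j = mu) (eigenvalue M mu).
Proof.
rewrite eigenvalue_root_char char_poly_diagonalization rootE horner_prod.
apply: (iffP (@prodf_eq0 _ _ _ _)) => [[j _]|[j <-]]; rewrite ?hornerXsubC ?subr_eq0.
  by move=> /eqP ->; exists j.
by exists j; rewrite // hornerXsubC subrr.
Qed.

Lemma mup_char_poly_diagonalization j0 :
  (forall j, d 0 j = d 0 j0 -> j = j0) -> mup (d 0 j0) (char_poly M) = 1%N.
Proof.
move=> dj; rewrite char_poly_diagonalization (bigD1 j0)//= mupMl.
  by rewrite -(expr1 ('X - _)) mup_XsubCX eqxx.
rewrite rootE horner_prod; apply/prodf_neq0 => j jj0.
by rewrite !hornerE subr_eq0; apply: contraNneq jj0 => /esym/dj ->.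
Qed.

End Diagonalization.

(** * Roots of unity and the Fourier basis *)

Lemma diagonalization_columns (K : fieldType) n (M V : 'M[K]_n) (d : 'rV[K]_n) :
  (forall j, M *m col j V = d 0 j *: col j V) -> M *m V = V *m diag_mx d.
Proof.
move=> MV; apply/matrixP => k j; have := MV j.
rewrite colE mulmxA -!colE => /colP/(_ k); rewrite mxE => ->.
by rewrite mul_mx_diag !mxE mulrC.
Qed.

Section Fourier.
Local Open Scope complex_scope.
Local Open Scope ring_scope.
Context {R : realType}.
Local Notation C := R[i].
Implicit Types (x F : R) (j k l n : nat).

Definition expi x : C := cos x +i* sin x.

Lemma expi0 : expi 0 = 1.
Proof. by rewrite /expi cos0 sin0. Qed.

Lemma expiD x y : expi (x + y) = expi x * expi y.
Proof.
rewrite /expi cosD sinD; apply/eqP; rewrite eq_complex /=.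
by apply/andP; split; apply/eqP; ring.
Qed.

Lemma expiX x k : expi x ^+ k = expi (k%:R * x).
Proof.
elim: k => [|k IHk]; first by rewrite mul0r expi0.
by rewrite exprS IHk -expiD -natr1 mulrDl mul1r addrC.
Qed.

Lemma expi_neq0 x : expi x != 0.
Proof.
have : expi x * expi (- x) != 0 by rewrite -expiD subrr expi0 oner_eq0.
by rewrite mulf_eq0 => /norP[].
Qed.

Lemma expiV x : (expi x)^-1 = expi (- x).
Proof.
by apply: (mulfI (expi_neq0 x)); rewrite -expiD subrr expi0 divff ?expi_neq0.
Qed.

Lemma conjc_expi x : conjc (expi x) = (expi x)^-1.
Proof. by rewrite expiV /expi cosN sinN. Qed.

Lemma expi2pi : expi (2 * pi) = 1.
Proof. by rewrite /expi mulr_natl cos2pi sin2pi. Qed.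

Lemma expi_neq1 x : 0 < x < 2 * pi -> expi x != 1.
Proof.
move=> x2pi; rewrite /expi eq_complex /= negb_and; apply/orP; left.
have s0 : 0 < sin (x / 2) by apply: sin_gt0_pi; move/andP: x2pi => ?; apply/andP; lra.
have -> : x = 2 * (x / 2) by field.
rewrite cos2x cos2sin2; apply/eqP => e; have := exprn_gt0 2 s0; lra.
Qed.

Definition zeta j n : C := expi (- ang 2 j n).

Lemma zeta_unity j n : (0 < n)%N -> zeta j n ^+ n = 1.
Proof.
move=> n0; have nn : n%:R != 0 :> R by rewrite pnatr_eq0 -lt0n.
rewrite expiX (_ : _ * _ = - (j%:R * (2 * pi))); last by rewrite /ang; field.
by rewrite -expiV -expiX expi2pi expr1n invr1.
Qed.

Lemma conjc_zeta j n : conjc (zeta j n) = (zeta j n)^-1.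
Proof. exact: conjc_expi. Qed.

Lemma zeta_inj j k n : (j < n)%N -> (k < n)%N -> zeta j n = zeta k n -> j = k.
Proof.
wlog jk : j k / (j <= k)%N => [hw|].
  by case/orP: (leq_total j k) => h jn kn e; [|apply/esym]; apply: hw.
move=> jn kn; rewrite leq_eqVlt in jk; case/predU1P: jk => // jk e.
have n0 : 0 < n%:R :> R by rewrite ltr0n (leq_ltn_trans _ kn).
have : expi (ang 2 k n - ang 2 j n) = 1.
  rewrite expiD -[expi (- _)]/(zeta j n) e -[expi (ang _ _ _)]invrK expiV.
  by rewrite -/(zeta k n) mulVf// /zeta expi_neq0.
move/eqP; rewrite (negbTE (expi_neq1 _ _))//.
have -> : ang 2 k n - ang 2 j n = 2 * pi * ((k - j)%:R / n%:R) :> R.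
  by rewrite natrB 1?ltnW// /ang; field; rewrite gt_eqF.
have tpi : 0 < 2 * pi :> R by rewrite mulr_gt0 ?pi_gt0.
rewrite mulr_gt0 ?divr_gt0 ?n0 ?ltr0n ?subn_gt0//=.
rewrite gtr_pMr// ltr_pdivrMr// mul1r ltr_nat.
exact: leq_ltn_trans (leq_subr _ _) kn.
Qed.

Lemma ang2 j n : ang 4 j n = 2 * ang 2 j n :> R.
Proof. by rewrite /ang !mulrA -natrM. Qed.

(** Links the plane-wave multiplier to the eigenvalue formula written with sines and
    cosines. *)
Lemma symbol_zeta F j n : symbol F (zeta j n) = lambda j n F.
Proof.
rewrite /symbol -exprVn expiV opprK expiX -ang2 /zeta /expi cosN sinN.
by rewrite /lambda /feig /geig; simpc.
Qed.

Lemma symbol_conj F (w : C) : symbol F (conjc w) = conjc (symbol F w).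
Proof.
rewrite /symbol rmorphD rmorphN rmorph1 rmorphM rmorphB /= conjc_inv rmorphXn/=.
by rewrite oppr0.
Qed.

Definition fourier n : 'M[C]_n := Vandermonde n (\row_j zeta j n).

Lemma col_fourier n (j : 'I_n) : col j (fourier n) = wave n (zeta j n).
Proof. by apply/colP => k; rewrite !mxE. Qed.

(** A Vandermonde matrix with distinct nodes is invertible. *)
Lemma fourier_unit n : fourier n \in unitmx.
Proof.
rewrite unitmxE det_Vandermonde unitfE.
apply/prodf_neq0 => i _; apply/prodf_neq0 => j ij.
rewrite !mxE subr_eq0; apply/eqP => /zeta_inj e.
by rewrite e ?ltn_ord// ltnn in ij.
Qed.

Definition eig_row n F : 'rV[C]_n := \row_j lambda j n F.

Lemma jacobian_fourier n F :
  jacobian_eqC n F *m fourier n = fourier n *m diag_mx (eig_row n F).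
Proof.
apply: diagonalization_columns => j.
rewrite col_fourier jacobian_eqC_wave ?zeta_unity ?(leq_ltn_trans _ (ltn_ord j))//.
by rewrite symbol_zeta mxE.
Qed.

Lemma jacobian_tr_fourier n F :
  (jacobian_eqC n F)^T *m fourier n =
  fourier n *m diag_mx (map_mx (@conjc R) (eig_row n F)).
Proof.
apply: diagonalization_columns => j.
rewrite col_fourier jacobian_eqC_tr_wave ?zeta_unity ?(leq_ltn_trans _ (ltn_ord j))//.
by rewrite -conjc_zeta symbol_conj symbol_zeta !mxE.
Qed.

End Fourier.

(** * Eigenvalues on the imaginary axis *)

Section Criticality.
Local Open Scope classical_set_scope.
Local Open Scope complex_scope.
Local Open Scope ring_scope.
Context {R : realType} (n l : nat).
Hypotheses (n_gt0 : (0 < n)%N) (l_gt0 : (0 < l)%N) (l_lt : (2 * l < n)%N)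
  (l_neq3 : (3 * l)%N <> n).
Local Notation C := R[i].
Local Notation theta := (ang 2 l n : R).

(** Tripling the angle gives cos (2 pi) = 1, and 4c^3 - 3c - 1 = (c - 1)(2c + 1)^2. *)
Lemma cos_2pi3 : cos (2 * pi / 3) = - (1 / 2) :> R.
Proof.
have pi0 := @pi_gt0 R.
have c1 : cos (2 * pi / 3) < 1 :> R.
  rewrite -[ltRHS]cos0 ltr_cos; first lra; rewrite in_itv/=; first by rewrite lexx ltW.
  by apply/andP; split; lra.
have : cos (3 * (2 * pi / 3)) = 1 :> R.
  by rewrite (_ : 3 * _ = pi *+ 2) ?cos2pi//; field.
rewrite cos3x; move: (cos _) c1 => c c1 e.
have : (c - 1) * (2 * c + 1) ^+ 2 = 4 * c ^+ 3 - 3 * c - 1 by ring.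
rewrite e subrr; move/eqP; rewrite mulf_eq0 expf_eq0 /= subr_eq0 lt_eqF//= => /eqP; lra.
Qed.

Lemma theta_itv : 0 < theta < pi.
Proof.
have n0 : 0 < n%:R :> R by rewrite ltr0n.
have l0 : 0 < l%:R :> R by rewrite ltr0n.
have ln : 2 * l%:R < n%:R :> R by rewrite -natrM ltr_nat.
have pi0 := @pi_gt0 R.
rewrite /ang; apply/andP; split; first by rewrite divr_gt0// !mulr_gt0.
rewrite ltr_pdivrMr//.
by have : 0 < pi * (n%:R - 2 * l%:R) :> R; [rewrite mulr_gt0// subr_gt0|nra].
Qed.

Lemma sin_theta_gt0 : 0 < sin theta.
Proof. exact: sin_gt0_pi theta_itv. Qed.

Lemma cos_theta_lt1 : cos theta < 1.
Proof.
have /andP[t0 tpi] := theta_itv.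
by rewrite -[ltRHS]cos0 ltr_cos// in_itv/= ?lexx ?pi_ge0 ?ltW.
Qed.

(** 1 + 2 cos t vanishes for t in (0, pi) only at t = 2 pi / 3, which is the excluded
    case l = n / 3. *)
Lemma cos_theta_neq : 1 + 2 * cos theta != 0.
Proof.
have /andP[t0 tpi] := theta_itv; have pi0 := @pi_gt0 R.
apply/eqP => e; apply: l_neq3.
have : theta = 2 * pi / 3.
  apply: cos_inj; last by rewrite cos_2pi3; lra.
    by rewrite in_itv/= !ltW.
  by rewrite in_itv/=; apply/andP; split; lra.
have n0 : n%:R != 0 :> R by rewrite pnatr_eq0 -lt0n.
rewrite /ang -mulrA => /(mulfI (lt0r_neq0 _)) h.
apply/eqP; rewrite -(eqr_nat R) natrM.
have {h} : l%:R / n%:R = 3^-1 :> R by apply: h; rewrite mulr_gt0.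
by move=> h; rewrite -(divfK n0 l%:R) h; apply/eqP; field.
Qed.

Lemma feig_cos j : feig j n = (1 - cos (ang 2 j n)) * (1 + 2 * cos (ang 2 j n)) :> R.
Proof. by rewrite /feig ang2 cos2x; ring. Qed.

Lemma geig_cos j : geig j n = - sin (ang 2 j n) * (1 + 2 * cos (ang 2 j n)) :> R.
Proof. by rewrite /geig ang2 sin2x; ring. Qed.

Lemma feig_neq0 : feig l n != 0 :> R.
Proof.
by rewrite feig_cos mulf_neq0 ?cos_theta_neq// subr_eq0 gt_eqF// cos_theta_lt1.
Qed.

(** This is cot (pi l / n), written so that it stays rational in the sine and cosine
    of 2 pi l / n. *)
Definition omega : R := sin theta / (1 - cos theta).

Lemma omega_gt0 : 0 < omega.
Proof. by rewrite divr_gt0 ?sin_theta_gt0// subr_gt0 cos_theta_lt1. Qed.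

Lemma ang_opp : ang 2 (n - l) n = 2 * pi - theta :> R.
Proof.
rewrite /ang natrB; last by rewrite (leq_trans _ (ltnW l_lt))// leq_pmull.
by field; rewrite pnatr_eq0 -lt0n.
Qed.

Lemma cos_opp : cos (ang 2 (n - l) n) = cos theta.
Proof. by rewrite ang_opp addrC mulr_natl cosD2pi cosN. Qed.

Lemma sin_opp : sin (ang 2 (n - l) n) = - sin theta.
Proof. by rewrite ang_opp addrC mulr_natl sinD2pi sinN. Qed.

Lemma zeta_opp : zeta (n - l) n = expi theta.
Proof. by rewrite /zeta /expi cosN sinN cos_opp sin_opp opprK. Qed.

(** Both f and g contain the factor 1 + 2 cos t, which cancels in g / f. *)
Lemma lambda_l : lambda l n (F_H l n) = 0 -i* omega.
Proof.
rewrite /lambda /F_H mulVf ?feig_neq0// addNr; congr (_ +i* _).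
rewrite /omega geig_cos feig_cos; field.
by rewrite cos_theta_neq subr_eq0 gt_eqF ?cos_theta_lt1.
Qed.

Lemma lambda_opp : lambda (n - l) n (F_H l n) = 0 +i* omega.
Proof.
have -> : lambda (n - l) n (F_H l n) = conjc (lambda l n (F_H l n)) :> C.
  by rewrite /lambda /= !feig_cos !geig_cos cos_opp sin_opp opprK -mulrN mulNr opprK.
by rewrite lambda_l /= opprK.
Qed.

(** The real part is affine in F; it cannot vanish with slope zero, since it would then
    be constantly -1. *)
Lemma crosses_imaginary_axisP j (F : R) :
  crosses_imaginary_axis (lambda j n) F <-> complex.Re (lambda j n F) = 0.
Proof.
split=> [[]//|] /= e; split; first exact: e.
have Ff : F * feig j n = 1 by lra.
have near_left (P : R -> Prop) : (forall x, x < F -> P x) -> \forall x \near F^'-, P x.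
  by move=> FP; near=> x; apply: FP; near: x; exact: nbhs_left_lt.
have near_right (P : R -> Prop) : (forall x, F < x -> P x) -> \forall x \near F^'+, P x.
  by move=> FP; near=> x; apply: FP; near: x; exact: nbhs_right_gt.
have Re_lin x : complex.Re (lambda j n x) = (x - F) * feig j n.
  by rewrite /= mulrBl Ff; ring.
have : feig j n != 0 :> R.
  by apply: contra_eq_neq Ff => ->; rewrite mulr0 eq_sym oner_eq0.
rewrite neq_lt => /orP[f0|f0]; [right|left]; split.
- by apply: near_left => x xF; rewrite Re_lin nmulr_lgt0// subr_lt0.
- by apply: near_right => x xF; rewrite Re_lin nmulr_llt0// subr_gt0.
- by apply: near_left => x xF; rewrite Re_lin pmulr_llt0// subr_lt0.
- by apply: near_right => x xF; rewrite Re_lin pmulr_lgt0// subr_gt0.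
Unshelve. all: by end_near. Qed.

End Criticality.

(** * The crossing condition and the Lyapunov formula *)

Section HopfData.
Local Open Scope classical_set_scope.
Local Open Scope complex_scope.
Local Open Scope ring_scope.
Context {R : realType} (n l : nat).
Hypotheses (n_gt0 : (0 < n)%N) (l_gt0 : (0 < l)%N) (l_lt : (2 * l < n)%N)
  (l_neq3 : (3 * l)%N <> n).
Local Notation C := R[i].
Local Notation theta := (ang 2 l n : R).
Local Notation F0 := (F_H l n : R).
Local Notation w0 := (omega n l : R).
Hypothesis only_l : only_crossing_pair n l F0.

Let w0_gt0 : 0 < w0 := omega_gt0 n l n_gt0 l_gt0 l_lt.
Let lam_l : lambda l n F0 = 0 -i* w0 := lambda_l n l n_gt0 l_gt0 l_lt l_neq3.
Let lam_opp : lambda (n - l) n F0 = 0 +i* w0 :=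
  lambda_opp n l n_gt0 l_gt0 l_lt l_neq3.

Let w0N : (- w0 == w0) = false.
Proof. by rewrite lt_eqF// (lt_trans _ w0_gt0)// oppr_lt0. Qed.

Let w0_neq0 : (w0 == 0) = false.
Proof. exact: gt_eqF. Qed.

Let w0_neq2 : (w0 == 2 * w0) = false.
Proof. by rewrite lt_eqF// ltr_pMl// ltr1n. Qed.

Let w0_neqN2 : (- w0 == 2 * w0) = false.
Proof. by rewrite lt_eqF// (lt_trans _ (mulr_gt0 _ w0_gt0))// oppr_lt0. Qed.

Lemma l_ltn : (l < n)%N.
Proof. by apply: leq_ltn_trans l_lt; rewrite leq_pmull. Qed.

Lemma opp_ltn : (n - l < n)%N.
Proof. by rewrite ltn_subrL l_gt0. Qed.

Definition ord_l : 'I_n := Ordinal l_ltn.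
Definition ord_opp : 'I_n := Ordinal opp_ltn.

(** An eigenvalue branch that meets the imaginary axis also crosses it, so the
    uniqueness of the crossing pair lists all eigenvalues on the axis. *)
Lemma lambda_imaginary (j : 'I_n) : complex.Re (lambda j n F0) = 0 ->
  j = ord_l \/ j = ord_opp.
Proof.
move=> /crosses_imaginary_axisP /(only_l j (ltn_ord j)).
by case=> e; [left|right]; apply: val_inj.
Qed.

Lemma lambda_eq_opp (j : 'I_n) : lambda j n F0 = 0 +i* w0 -> j = ord_opp.
Proof.
move=> e; have [|jl|//] := lambda_imaginary j; first by rewrite e.
by move: e; rewrite jl [lambda _ _ _]lam_l => -[/eqP]; rewrite w0N.
Qed.

Lemma lambda_eq_l (j : 'I_n) : lambda j n F0 = 0 -i* w0 -> j = ord_l.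
Proof.
move=> e; have [|//|jl] := lambda_imaginary j; first by rewrite e.
by move: e; rewrite jl [lambda _ _ _]lam_opp => -[/esym/eqP]; rewrite w0N.
Qed.

Let AV := @jacobian_fourier R n F0.
Let V_unit := @fourier_unit R n.

Lemma jacobian_imaginary_pair_crossing :
  imaginary_pair_crossing (jacobian_eqC n) F0.
Proof.
exists w0 => //; split.
- move=> z; split.
    move=> [/(eigenvalue_diagonalization _ _ _ _ AV V_unit)[j <-]].
    rewrite mxE => /lambda_imaginary[->|->]; [right; exact: lam_l|].
    by left; exact: lam_opp.
  move=> zE; split; last by case: zE => ->.
  apply/(eigenvalue_diagonalization _ _ _ _ AV V_unit).
  by case: zE => ->; [exists ord_opp|exists ord_l]; rewrite mxE.
- have := mup_char_poly_diagonalization _ _ _ _ AV V_unit ord_opp.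
  rewrite mxE [lambda _ _ _]lam_opp; apply => j.
  by rewrite mxE; exact: lambda_eq_opp.
- have := mup_char_poly_diagonalization _ _ _ _ AV V_unit ord_l.
  rewrite mxE [lambda _ _ _]lam_l; apply => j.
  by rewrite mxE; exact: lambda_eq_l.
have dlin a b : is_derive F0 1 (fun F : R => a + F * b) b.
  by apply: is_derive_eq; rewrite /GRing.scale/=; ring.
(* The branch through + i omega is the one with index n - l. *)
exists (lambda (n - l) n); split=> //.
- near=> F; apply/(eigenvalue_diagonalization _ _ _ _ (@jacobian_fourier R n F) V_unit).
  by exists ord_opp; rewrite mxE.
rewrite derive1E /=; have [_ ->] := dlin (-1) (feig (n - l) n).
rewrite feig_cos cos_opp// -feig_cos.
exact: feig_neq0.
Unshelve. all: by end_near. Qed.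

Lemma jacobian_unit : jacobian_eqC n F0 \in unitmx.
Proof.
apply: (unitmx_diagonalization _ _ _ _ AV V_unit) => j; rewrite mxE.
apply/eqP => e; have [|jl|jl] := lambda_imaginary j; first by rewrite e.
- by move: e; rewrite jl [lambda _ _ _]lam_l => -[] /eqP; rewrite oppr_eq0 w0_neq0.
- by move: e; rewrite jl [lambda _ _ _]lam_opp => -[] /eqP; rewrite w0_neq0.
Qed.

Lemma jacobian_2iw_unit :
  (0 +i* (2 * w0))%:M - jacobian_eqC n F0 \in unitmx.
Proof.
pose d : 'rV[C]_n := \row_j ((0 +i* (2 * w0)) - lambda j n F0).
apply: (@unitmx_diagonalization _ _ _ (fourier n) d) => [| |j]; last first.
- rewrite mxE subr_eq0; apply/eqP => e.
  have [|jl|jl] := lambda_imaginary j; first by rewrite -e.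
  + by move: e; rewrite jl [lambda _ _ _]lam_l => -[] /eqP; rewrite eq_sym w0_neqN2.
  + by move: e; rewrite jl [lambda _ _ _]lam_opp => -[] /eqP; rewrite eq_sym w0_neq2.
- exact: V_unit.
apply: diagonalization_columns => j; rewrite mulmxBl mul_scalar_mx col_fourier.
rewrite jacobian_eqC_wave ?zeta_unity// symbol_zeta -scalerBl.
by rewrite mxE.
Qed.

(** The eigenvalue i omega is simple for A and its conjugate for the transpose, so
    q and p are multiples of the same plane wave; the normalizations only leave a
    phase. *)
Lemma critical_eigenvectorsP w q p :
  critical_eigenvectors (jacobian_eqC n F0) w q p ->
  w = w0 /\ exists a b : C, [/\ q = a *: wave n (expi theta),
    p = b *: wave n (expi theta), conjc a * a * n%:R = 1 &
    conjc b * a * n%:R = 1].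
Proof.
move=> [w_gt0 Aq Ap qq pq].
have q0 : q != 0.
  apply: contra_eq_neq qq => ->; rewrite /cdot big1 1?eq_sym ?oner_eq0// => k _.
  by rewrite mxE mulr0.
have wE : w = w0.
  have [j] := eigenvalue_in_diagonal _ _ _ _ AV V_unit _ _ Aq q0.
  rewrite mxE => e; have [|jl|jl] := lambda_imaginary j; first by rewrite e.
  - move: e; rewrite jl [lambda _ _ _]lam_l => -[] h.
    by move: w_gt0; rewrite -h oppr_gt0 ltNge ltW.
  - by move: e; rewrite jl [lambda _ _ _]lam_opp => -[].
have colE : col ord_opp (fourier n) = wave n (expi theta).
  by rewrite col_fourier /= zeta_opp.
rewrite {}wE in Aq Ap *; split => //.
have [a qE] : exists a, q = a *: wave n (expi theta).
  rewrite -colE; apply: (eigenvector_line _ _ _ _ AV V_unit _ _ _ Aq) => j.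
  by rewrite mxE; exact: lambda_eq_opp.
have [b pE] : exists b, p = b *: wave n (expi theta).
  rewrite -colE.
  apply: (eigenvector_line _ _ _ _ (@jacobian_tr_fourier R n F0) V_unit _ _ _ Ap) => j.
  rewrite !mxE => e; apply: lambda_eq_opp.
  by rewrite -[LHS]conjcK e /= opprK.
have ww := cdot_wave n _ (conjc_expi theta) (expi_neq0 theta).
by exists a, b; move: qq pq; rewrite qE pE !cdot_scale ww.
Qed.

(** Witness: the plane wave divided by sqrt n. *)
Lemma critical_eigenvectors_exist :
  exists q, critical_eigenvectors (jacobian_eqC n F0) w0 q q.
Proof.
have zn : expi theta ^+ n = 1 :> C by rewrite -zeta_opp// zeta_unity.
have n0 : 0 < n%:R :> R by rewrite ltr0n.
pose a : C := (Num.sqrt n%:R)^-1%:C.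
have aa : conjc a * a * n%:R = 1.
  rewrite /a conjc_real -rmorphM -(rmorph_nat (real_complex R)) -rmorphM.
  by rewrite -invfM -expr2 sqr_sqrtr ?ltW// mulVf ?gt_eqF.
have ww := cdot_wave n _ (conjc_expi theta) (expi_neq0 theta).
have Sz : symbol F0 (expi theta) = 0 +i* w0.
  by rewrite -lam_opp -symbol_zeta zeta_opp.
exists (a *: wave n (expi theta)); split; rewrite ?cdot_scale ?ww//.
- by rewrite -scalemxAr jacobian_eqC_wave// Sz !scalerA mulrC.
- rewrite -scalemxAr jacobian_eqC_tr_wave// -conjc_expi symbol_conj Sz.
  by rewrite !scalerA mulrC.
Qed.

(** For m = 0 both sides vanish, since M x = 0 forces x = 0. *)
Lemma invmx_eigenvector (K : fieldType) (M : 'M[K]_n) (m : K) (x : 'cV[K]_n) :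
  M \in unitmx -> M *m x = m *: x -> invmx M *m x = m^-1 *: x.
Proof.
move=> Mu Mx; have xE : x = m *: (invmx M *m x) by rewrite scalemxAr -Mx mulKmx.
have [m0|m0] := eqVneq m 0; last by rewrite {2}xE scalerK.
by move: xE; rewrite m0 scale0r => ->; rewrite mulmx0 scaler0.
Qed.

(** Applied to waves, B and the two inverse matrices act by scalars.  The phases of
    q and p enter only through the two normalizations, so the value does not depend on
    them. *)
Lemma lyapunov_formula_wave (a b : C) :
  conjc a * a * n%:R = 1 -> conjc b * a * n%:R = 1 ->
  let z : C := expi theta in
  lyapunov_formula (jacobian_eqC n F0) w0 (a *: wave n z) (b *: wave n z) =
  (2 * w0)^-1 * complex.Re (n%:R^-1 *
    (2 * bsymbol z z^-1 * bsymbol z 1 + bsymbol z z * bsymbol z^-1 (z * z) /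
       (0 +i* (2 * w0) - symbol F0 (z * z)))).
Proof.
move=> aa ba z; have zn : z ^+ n = 1 by rewrite /z -zeta_opp// zeta_unity.
have zVn : z^-1 ^+ n = 1 by rewrite exprVn zn invr1.
have z2n : (z * z) ^+ n = 1 by rewrite exprMn zn mulr1.
have n1 : (1 : C) ^+ n = 1 by rewrite expr1n.
have cz : conjc z = z^-1 := conjc_expi theta.
have z0 : z != 0 := expi_neq0 theta.
have ww := cdot_wave n _ cz z0.
rewrite /lyapunov_formula conj_cV_wave// !Bform_scale !Bform_wave//.
rewrite divff// !scalerA -!scalemxAr.
rewrite (@invmx_eigenvector _ _ (symbol F0 1)); last 2 first.
- exact: jacobian_unit.
- exact: jacobian_eqC_wave.
rewrite (@invmx_eigenvector _ _ (0 +i* (2 * w0) - symbol F0 (z * z))); last 2 first.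
- exact: jacobian_2iw_unit.
- by rewrite mulmxBl mul_scalar_mx jacobian_eqC_wave// scalerBl.
rewrite !scalerA !Bform_scale !Bform_wave// mulr1 mulrA mulVf// mul1r.
rewrite !scalerA !cdot_scale ww /symbol expr1n invr1 subrr mulr0 addr0 invrN1.
congr (_ * complex.Re _).
have n0 : n%:R != 0 :> C by rewrite pnatr_eq0 -lt0n.
have -> : (n%:R : C)^-1 = conjc a * a by apply: (mulIf n0); rewrite mulVf.
move: (bsymbol _ _) (bsymbol _ _) (bsymbol _ _) (bsymbol _ _) => B1 B2 B3 B4.
move: (_^-1) => D.
transitivity ((conjc b * a * n%:R) *
  (conjc a * a * (2 * B4 * B3 + B2 * B1 * D))); first by ring.
by rewrite ba mul1r.
Qed.

End HopfData.

(** * The Lyapunov coefficient in closed form *)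

Section ClosedForm.
Local Open Scope complex_scope.
Local Open Scope ring_scope.
Context {R : realType}.
Local Notation C := R[i].
Implicit Types (x F : R).

Lemma ReZ (r : R) (u : C) : complex.Re (r%:C * u) = r * complex.Re u.
Proof. by case: u => a b /=; rewrite mul0r subr0. Qed.

Lemma ReD (u v : C) : complex.Re (u + v) = complex.Re u + complex.Re v.
Proof. by case: u v => a b [a' b']. Qed.

Lemma Re_divc (r a b : R) :
  complex.Re (r%:C / (a +i* b)) = r * (a / (a ^+ 2 + b ^+ 2)).
Proof. by rewrite ReZ. Qed.

Lemma expi_addV x : expi x + expi (- x) = (2 * cos x)%:C.
Proof.
rewrite /expi cosN sinN; apply/eqP; rewrite eq_complex /= subrr eqxx andbT.
by apply/eqP; ring.
Qed.

Lemma symbol_expi F x : symbol F (expi x) =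
  (- 1 + F * (cos x - cos (2 * x))) +i* (F * (sin x + sin (2 * x))).
Proof.
rewrite /symbol -exprVn expiV expiX mulrN /expi cosN sinN.
by apply/eqP; rewrite eq_complex /=; apply/andP; split; apply/eqP; ring.
Qed.

Lemma bsymbol_conj x :
  bsymbol (expi x) (expi x)^-1 = (2 * cos (2 * x) - 2 * cos x)%:C.
Proof.
rewrite rmorphB/= -!expi_addV -mulrN -!expiX -expiV /bsymbol.
by have := expi_neq0 x; move: (expi x) => z z0; field.
Qed.

Lemma Re_bsymbol_const x :
  complex.Re (bsymbol (expi x) 1) = cos x - cos (2 * x).
Proof.
rewrite /bsymbol expr1n invr1 subrr mulr0 add0r mul1r -exprVn expiV expiX mulrN.
by rewrite /expi cosN sinN.
Qed.

(** The two multipliers are 2 (1 - z^-3) and z^3 - 1, and their product is real because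
    z has modulus one. *)
Lemma bsymbol_square x : let z := expi x in
  bsymbol z z * bsymbol z^-1 (z * z) = (4 * cos (3 * x) - 4)%:C.
Proof.
move=> z; have z0 : z != 0 := expi_neq0 x.
have -> : bsymbol z z * bsymbol z^-1 (z * z) = 2 * (z ^+ 3 + z^-1 ^+ 3 - 2).
  by rewrite /bsymbol; field.
rewrite /z expiV !expiX mulrN expi_addV.
rewrite -!(rmorph_nat (real_complex R)) -rmorphB -rmorphM; congr (_%:C); ring.
Qed.

(** Write c and s for cos x and sin x.  The denominator 2 i w - symbol (z^2) equals
    (3 - 2c - 4c^2) + 2 i s (1 + 2c), and its squared modulus is the denominator
    13 + 4c - 8c^2 of the formula.  The first summand contributes
    -4 (1-c)^2 (1+2c)^2, and the second has numerator
    4 (4c^3 - 3c - 1) (3 - 2c - 4c^2) = -4 (1-c)(1+2c)^2 (3 - 2c - 4c^2);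
    taking out the common factor leaves the cubic. *)
Lemma Re_lyapunov_bracket (n : nat) (w F x : R) (c := cos x) (s := sin x) :
  c != 1 -> 1 + 2 * c != 0 -> F = ((1 - c) * (1 + 2 * c))^-1 ->
  w = s / (1 - c) -> let z := expi x in
  complex.Re (n%:R^-1 *
    (2 * bsymbol z z^-1 * bsymbol z 1 + bsymbol z z * bsymbol z^-1 (z * z) /
       (0 +i* (2 * w) - symbol F (z * z)))) =
  4 / n%:R * ((1 - c) * (1 + 2 * c) ^+ 2) *
    (lyap_cubic c / (4 * c - 4 * cos (2 * x) + 9)).
Proof.
move=> c1 c2 FE wE z.
have -> : (0 +i* (2 * w) : C) - symbol F (z * z) =
    (3 - 2 * c - 4 * c ^+ 2) +i* (2 * s * (1 + 2 * c)).
  rewrite /z -expiD symbol_expi -mulr2n -[x *+ 2]mulr_natl !cos2x !sin2x cos2x.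
  have s2 : s ^+ 2 = 1 - c ^+ 2 by rewrite sin2cos2.
  rewrite wE FE -/c -/s; simpc; congr (_ +i* _); field.
    by rewrite c2 subr_eq0 eq_sym.
  by rewrite c2 subr_eq0 eq_sym.
rewrite bsymbol_conj bsymbol_square -(rmorph_nat (real_complex R) n) -fmorphV ReZ.
rewrite ReD Re_divc -(rmorph_nat (real_complex R) 2) -rmorphM ReZ.
rewrite Re_bsymbol_const cos3x cos2x -/c.
have -> : (2 * s * (1 + 2 * c)) ^+ 2 = 4 * (1 - c ^+ 2) * (1 + 2 * c) ^+ 2.
  by have <- : s ^+ 2 = 1 - c ^+ 2 := sin2cos2 x; ring.
have Q : 4 * c - 4 * (2 * c ^+ 2 - 1) + 9 != 0.
  have := cos_geN1 x; have := cos_le1 x; rewrite -/c => h1 h2.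
  by rewrite gt_eqF//; nra.
clearbody c.
have Q2 : (3 - 2 * c - 4 * c ^+ 2) ^+ 2 + 4 * (1 - c ^+ 2) * (1 + 2 * c) ^+ 2 =
    4 * c - 4 * (2 * c ^+ 2 - 1) + 9 by ring.
rewrite {}Q2 /lyap_cubic; move: (n%:R^-1) => N; field.
exact: Q.
Qed.

Lemma lyap_denominator_gt0 x : 0 < 4 * cos x - 4 * cos (2 * x) + 9.
Proof.
rewrite cos2x; have := cos_geN1 x; have := cos_le1 x => h1 h2; nra.
Qed.

End ClosedForm.

(** * Irrationality of the critical ratio *)

(** Clearing denominators in a monic relation p(1/2) = 0 of degree d gives
    2 S + 1 = 0 for an integer S. *)
Lemma half_not_integral (K : numFieldType) :
  ~ integralOver (intr : int -> K) (2^-1).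
Proof.
case=> p p_monic; rewrite rootE horner_coef size_map_inj_poly ?rmorph0//; last first.
  exact: intr_inj.
have p0 := monic_neq0 p_monic.
have sp : size p = (size p).-1.+1 by rewrite prednK// lt0n size_poly_eq0.
rewrite sp big_ord_recr /= coef_map /= -[p`_(size p).-1]/(lead_coef p).
rewrite (monicP p_monic) mulr1z mul1r; set d := (size p).-1.
pose S : int := \sum_(i < d) p`_i * 2 ^+ (d - i).-1.
have -> : \sum_(i < d) (map_poly intr p)`_i * (2^-1) ^+ i =
    (2 * S)%:~R * 2^-1 ^+ d :> K.
  rewrite rmorphM rmorph_sum /= mulr_sumr mulr_suml; apply: eq_bigr => i _.
  rewrite coef_map /= rmorphM rmorphXn /=.
  have -> : 2^-1 ^+ d = 2^-1 ^+ i * 2^-1 ^+ (d - i).-1.+1 :> K.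
    by rewrite -exprD prednK ?subn_gt0// subnKC// ltnW.
  move: (d - i).-1 (p`_i) => k a.
  have e : 2%:~R * 2%:~R ^+ k * 2^-1 ^+ k.+1 = 1 :> K.
    by rewrite -exprS -exprMn divff ?expr1n// intr_eq0.
  transitivity (a%:~R * 2^-1 ^+ i * (2%:~R * 2%:~R ^+ k * 2^-1 ^+ k.+1) : K).
    by rewrite e mulr1.
  move: (2^-1 ^+ i) (2%:~R ^+ k) (2^-1 ^+ k.+1) => x y z; ring.
rewrite -[X in _ + X]mul1r -mulrDl -[1]/(1%:~R) -intrD mulf_eq0.
rewrite expf_eq0 invr_eq0 pnatr_eq0 andbF orbF intr_eq0.
move/eqP => e; have : (2 %| 2 * S + 1)%Z by rewrite e dvdz0.
by rewrite rpredDl ?dvdz_mulr.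
Qed.

Section RationalAngles.
Local Open Scope complex_scope.
Local Open Scope ring_scope.
Context {R : realType}.
Local Notation C := R[i].
Local Notation integral := (integralOver (intr : int -> C)).
Implicit Types (x : R) (k n l : nat).

Lemma integral_unity_root (w : C) n : (0 < n)%N -> w ^+ n = 1 -> integral w.
Proof.
move=> n0 wn; exists ('X^n - 1); first exact: monicXnsubC.
by rewrite rmorphB rmorph1 /= map_polyXn rootE !hornerE wn subrr.
Qed.

Lemma integral_2cos x n : (0 < n)%N -> expi x ^+ n = 1 ->
  integral (2 * cos x)%:C.
Proof.
move=> n0 xn; rewrite -expi_addV; apply: integral_add.
  exact: integral_unity_root xn.
by rewrite -expiV; apply: (@integral_unity_root _ n) => //; rewrite exprVn xn invr1.
Qed.

Lemma half_not_integralC : ~ integral (2^-1)%:C.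
Proof. by rewrite fmorphV rmorph_nat; exact: half_not_integral. Qed.

Lemma integral_real_nat k : integral (k%:R)%:C.
Proof. by rewrite rmorph_nat; exact: integral_nat. Qed.

Lemma integral_cos_double x k : integral (cos x)%:C ->
  integral (cos (2 ^+ k * x))%:C.
Proof.
move=> ix; elim: k => [|k IHk]; first by rewrite mul1r.
rewrite exprS -mulrA cos2x rmorphB rmorphM rmorphXn /= rmorph1 rmorph_nat expr2.
apply: integral_sub; last exact: integral1.
by apply: integral_mul; [exact: integral_nat|exact: integral_mul].
Qed.

(** Each doubling of the angle multiplies cos y - 1 by 2 (cos y + 1), so m doublings
    contribute a factor 2 ^ m up to an algebraic integer. *)
Lemma cos_double_product x k m : exists2 u : R,
  cos (2 ^+ (k + m) * x) - 1 = 2 ^+ m * (cos (2 ^+ k * x) - 1) * u &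
  integral (cos x)%:C -> integral u%:C.
Proof.
elim: m => [|m [u e iu]].
  by exists 1; [rewrite addn0 mul1r mulr1|move=> _; rewrite rmorph1; exact: integral1].
exists (u * (cos (2 ^+ (k + m) * x) + 1)).
  rewrite addnS (exprS _ (k + m)) -mulrA cos2x (exprS _ m).
  move: (cos (2 ^+ (k + m) * x)) e => c e.
  transitivity (2 * (c - 1) * (c + 1)); first by ring.
  by rewrite e; ring.
move=> ix; rewrite rmorphM rmorphD rmorph1; apply: integral_mul; first exact: iu.
by apply: integral_add; [exact: integral_cos_double|exact: integral1].
Qed.

(** Going back one doubling solves 2 c^2 - 1 = 0, 1 or -1; the first case would make
    c^2 = 1/2 an algebraic integer. *)
Lemma cos_double_descent x k : integral (cos x)%:C ->
  cos (2 ^+ k * x) \in [:: 0; 1; - 1] -> cos x \in [:: 0; 1; - 1].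
Proof.
move=> ix; elim: k => [|k IHk]; first by rewrite mul1r.
move=> h; apply: IHk; move: h; rewrite exprS -mulrA cos2x.
have := integral_cos_double x k ix; move: (cos _) => c ic.
rewrite !inE => /or3P[]/eqP e.
- have c2 : c ^+ 2 = 2^-1 by lra.
  case: half_not_integralC; rewrite -c2 rmorphXn /= expr2.
  exact: integral_mul.
- have /eqP : c ^+ 2 = 1 by lra.
  by rewrite sqrf_eq1 => /orP[]->; rewrite /= !orbT.
- have /eqP : c ^+ 2 = 0 by lra.
  by rewrite sqrf_eq0 => ->.
Qed.

(** The angles 2 ^ k x take finitely many values modulo 2 pi, so two of them agree,
    say for i < j.  By [cos_double_product] the number d = cos (2 ^ i x) - 1 satisfies
    d = 2 ^ (j - i) d u with u an algebraic integer.  If d were nonzero then 1/2 would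
    be an algebraic integer; hence cos (2 ^ i x) = 1, and [cos_double_descent] leads
    back to x. *)
Lemma integral_cos_rational_angle x n : (0 < n)%N -> expi x ^+ n = 1 ->
  integral (cos x)%:C -> cos x \in [:: 0; 1; - 1].
Proof.
move=> n0 xn ix.
(* Pigeonhole on the residues of 2 ^ i modulo n. *)
pose f (i : 'I_n.+1) : 'I_n := Ordinal (ltn_pmod (2 ^ i) n0).
have [i [j ij fij]] : exists i : 'I_n.+1, exists2 j : 'I_n.+1, (i < j)%N & f i = f j.
  have /injectivePn[i [j ij fij]] : ~~ injectiveb f.
    by apply/injectiveP => /leq_card; rewrite !card_ord ltnn.
  have [lij|lij|/val_inj e] := ltngtP i j; last by rewrite e eqxx in ij.
    by exists i, j.
  by exists j, i.
have cE k : expi (2 ^+ k * x) = expi x ^+ (2 ^ k %% n).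
  by rewrite -natrX -expiX expr_mod.
have e : cos (2 ^+ j * x) = cos (2 ^+ i * x).
  have := cE j; rewrite -[(_ %% _)%N]/(val (f j)) -fij -[val _]/(2 ^ i %% n)%N -cE.
  by case.
have [u] := cos_double_product x i (j - i).
rewrite subnKC 1?ltnW// e => eu /(_ ix) iu.
apply: (cos_double_descent x i) => //; rewrite !inE.
have [d0|d0] := eqVneq (cos (2 ^+ i * x) - 1) 0.
  by move/eqP: d0; rewrite subr_eq0 => ->; rewrite orbT.
case: half_not_integralC.
have -> : 2^-1 = 2 ^+ (j - i).-1 * u.
  apply: (mulfI (_ : (2 : R) != 0)); first by rewrite pnatr_eq0.
  rewrite divff ?pnatr_eq0// mulrA -exprS prednK ?subn_gt0//.
  by apply: (mulfI d0); rewrite mulr1 {1}eu; ring.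
rewrite rmorphM; apply: integral_mul; last exact: iu.
by rewrite -natrX; exact: integral_real_nat.
Qed.

(** With t = 2 cos x the equation P (cos x) = 0 reads 11 cos x = t^3 - 4 t^2 + 16.
    As t is an algebraic integer, so is cos x = 11 cos x - 5 t. *)
Lemma lyap_cubic_rational_angle_neq0 x n : (0 < n)%N -> expi x ^+ n = 1 ->
  lyap_cubic (cos x) != 0.
Proof.
move=> n0 xn; apply/eqP => r0.
have it := integral_2cos x n n0 xn.
have ic : integral (cos x)%:C.
  move tE : (2 * cos x) it => t it.
  have -> : cos x = (t * t * t - 4%:R * (t * t) + 16%:R) - 5%:R * t.
    by move: r0; rewrite /lyap_cubic -tE; move: (cos x) => c h; lra.
  have iN := integral_real_nat.
  rewrite rmorphB rmorphD rmorphB !rmorphM.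
  apply: integral_sub; last by apply: integral_mul; [exact: iN|exact: it].
  apply: integral_add; last exact: iN.
  apply: integral_sub; last first.
    by apply: integral_mul; [exact: iN|exact: integral_mul].
  by do 2!apply: integral_mul => //.
have := integral_cos_rational_angle x n n0 xn ic; rewrite !inE => /or3P[]/eqP e.
all: by move: r0; rewrite e /lyap_cubic; lra.
Qed.

End RationalAngles.

(** * Sign and nonvanishing of the coefficient *)

Section Ell1.
Context {R : realType} (n l : nat).
Hypotheses (n_gt0 : (0 < n)%N) (l_gt0 : (0 < l)%N) (l_lt : (2 * l < n)%N)
  (l_neq3 : (3 * l)%N <> n).
Local Notation theta := (ang 2 l n : R).
Local Notation w0 := (omega n l : R).

(** The positive factor left when the cubic is taken out of the coefficient;
    here tan (t / 2) = 1 / omega and 2 sin^2 (3t / 2) = (1 - cos t)(1 + 2 cos t)^2. *)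
Definition ell1_factor : R :=
  2 / n%:R / w0 * ((1 - cos theta) * (1 + 2 * cos theta) ^+ 2) /
  (4 * cos theta - 4 * cos (2 * theta) + 9).

Lemma tan_half : tan (ang 1 l n) = w0^-1 :> R.
Proof.
have thE : theta = 2 * ang 1 l n by rewrite /ang; ring.
have s0 := @sin_theta_gt0 R n l n_gt0 l_gt0 l_lt.
rewrite /omega /tan; move: s0; rewrite thE cos2x sin2x cos2sin2.
move: (ang 1 l n : R) => h s0.
have [c0 sh0] : cos h != 0 /\ sin h != 0.
  by split; apply: contraTneq s0 => ->; rewrite !(mulr0, mul0r) ltxx.
have -> : 1 - (2 * (1 - sin h ^+ 2) - 1) = 2 * sin h ^+ 2 by ring.
by field; rewrite sh0 c0.
Qed.

Lemma sin_three_half :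
  sin (ang 3 l n) ^+ 2 = (1 - cos theta) * (1 + 2 * cos theta) ^+ 2 / 2 :> R.
Proof.
have -> : sin (ang 3 l n) ^+ 2 = (1 - cos (3 * theta)) / 2 :> R.
  have -> : 3 * theta = 2 * ang 3 l n by rewrite /ang; ring.
  by rewrite cos2x cos2sin2; field.
by rewrite cos3x; field.
Qed.

Lemma ell1E : ell1 l n = ell1_factor * lyap_cubic (cos theta).
Proof.
have a4 : ang 4 l n = 2 * theta by rewrite ang2.
have a6 : ang 6 l n = 3 * theta by rewrite /ang; ring.
rewrite /ell1 tan_half sin_three_half a4 a6 cosine_lyap_cubic /ell1_factor.
have Q := lt0r_neq0 (lyap_denominator_gt0 theta).
have w := lt0r_neq0 (omega_gt0 n l n_gt0 l_gt0 l_lt : 0 < w0).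
have N : n%:R != 0 :> R by rewrite pnatr_eq0 -lt0n.
move: (lyap_cubic _) (4 * _ - _ + _) (n%:R : R) (omega n l : R) Q w N.
by move=> P Q N w Q0 w_0 N0; field; rewrite Q0 w_0 N0.
Qed.

Lemma ell1_factor_gt0 : 0 < ell1_factor.
Proof.
have w_gt0 := omega_gt0 n l n_gt0 l_gt0 l_lt : 0 < w0.
apply: divr_gt0; last exact: lyap_denominator_gt0.
apply: mulr_gt0; first by apply: divr_gt0 => //; apply: divr_gt0; rewrite ?ltr0n.
apply: mulr_gt0; first by rewrite subr_gt0 cos_theta_lt1.
by rewrite exprn_even_gt0//= cos_theta_neq.
Qed.

Hypothesis only_l : only_crossing_pair n l (F_H l n : R).

Lemma first_lyapunov_coefficient_ell1 :
  first_lyapunov_coefficient n (F_H l n) (ell1 l n : R).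
Proof.
split.
  have [q qP] := @critical_eigenvectors_exist R n l n_gt0 l_gt0 l_lt l_neq3.
  by exists w0, q, q.
move=> w q p /(critical_eigenvectorsP _ _ n_gt0 l_gt0 l_lt l_neq3 only_l).
move=> [-> [a [b [-> -> aa ba]]]].
rewrite (lyapunov_formula_wave _ _ n_gt0 l_gt0 l_lt l_neq3 only_l)//.
have c1 := cos_theta_lt1 n l n_gt0 l_gt0 l_lt : cos theta < 1.
rewrite Re_lyapunov_bracket; first last.
- by [].
- by rewrite /F_H feig_cos.
- exact: cos_theta_neq.
- by rewrite lt_eqF.
rewrite ell1E /ell1_factor.
have Q := lt0r_neq0 (lyap_denominator_gt0 theta).
have w1 := lt0r_neq0 (omega_gt0 n l n_gt0 l_gt0 l_lt : 0 < w0).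
have N : n%:R != 0 :> R by rewrite pnatr_eq0 -lt0n.
move: (lyap_cubic _) (4 * _ - _ + _) (n%:R : R) (omega n l : R) Q w1 N.
by move=> P Q N w' Q0 w_0 N0; field; rewrite Q0 w_0 N0.
Qed.

Lemma hopf_bifurcation_ell1 : (ell1 l n : R) != 0 ->
  hopf_bifurcation n (F_H l n : R).
Proof.
move=> e0; split; first exact: (jacobian_imaginary_pair_crossing n l).
by exists (ell1 l n) => //; exact: first_lyapunov_coefficient_ell1.
Qed.

End Ell1.

Theorem theorem4 (R : realType) (n l : nat)
    (hn : (4 <= n)%N) (hl0 : (0 < l)%N) (hl2 : (2 * l < n)%N)
    (hl3 : (3 * l)%N <> n) :
  (only_crossing_pair n l (F_H l n : R) ->
     hopf_bifurcation n (F_H l n : R) /\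
     first_lyapunov_coefficient n (F_H l n : R) (ell1 l n)) /\
  (exists y0 : R, is_y0 y0) /\
  (forall y0 : R, is_y0 y0 ->
     [/\ `|y0 / (2 * pi) - y0_ratio_approx| < 5 / 10 ^+ 9,
         0 < (l%:R / n%:R : R) < y0 / (2 * pi) ->
           0 < (ell1 l n : R) /\
           (only_crossing_pair n l (F_H l n : R) ->
              subcritical_hopf n (F_H l n : R)) &
         y0 / (2 * pi) < (l%:R / n%:R : R) < 1 / 2 ->
         (l%:R / n%:R : R) != 1 / 3 ->
           (ell1 l n : R) < 0 /\
           (only_crossing_pair n l (F_H l n : R) ->
              supercritical_hopf n (F_H l n : R))]).
Proof.
have n_gt0 : (0 < n)%N by exact: leq_trans hn.
have ell1E := @ell1E R n l n_gt0 hl0 hl2.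
have K_gt0 := @ell1_factor_gt0 R n l n_gt0 hl0 hl2 hl3.
have ell1_neq0 : ell1 l n != 0 :> R.
  rewrite ell1E mulf_neq0 ?(lt0r_neq0 K_gt0)//.
  apply: (lyap_cubic_rational_angle_neq0 _ n) => //.
  by rewrite -zeta_opp// zeta_unity.
have hopf := @hopf_bifurcation_ell1 R n l n_gt0 hl0 hl2 hl3.
have lyap := @first_lyapunov_coefficient_ell1 R n l n_gt0 hl0 hl2 hl3.
have /andP[th_gt0 th_ltpi] := @theta_itv R n l n_gt0 hl0 hl2.
have tpi : 0 < 2 * pi :> R by rewrite mulr_gt0 ?pi_gt0.
have thE : l%:R / n%:R = ang 2 l n / (2 * pi) :> R.
  have N : n%:R != 0 :> R by rewrite pnatr_eq0 -lt0n.
  rewrite /ang; move: (pi : R) (n%:R : R) (lt0r_neq0 (@pi_gt0 R)) N => a N a0 N0.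
  by field; rewrite a0 N0.
split; first by move=> only_l; split; [exact: hopf|exact: lyap].
split; first exact: exists_y0.
move=> y0 y0P; split; first exact: y0_ratio_bound.
- rewrite thE ltr_pM2r ?invr_gt0// => /andP[_ th_lt].
  have ell1_gt0 : 0 < ell1 l n :> R.
    rewrite ell1E mulr_gt0//; apply: (lyap_cubic_cos_gt0 y0) => //.
    by rewrite ltW.
  split=> // only_l; split; first exact: hopf.
  by exists (ell1 l n) => //; exact: lyap.
- rewrite thE ltr_pM2r ?invr_gt0// => /andP[th_gt _] _.
  have ell1_lt0 : ell1 l n < 0 :> R.
    rewrite ell1E pmulr_rlt0//; apply: (lyap_cubic_cos_lt0 y0) => //.
    by rewrite th_gt ltW.
  split=> // only_l; split; first exact: hopf.
  by exists (ell1 l n) => //; exact: lyap.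
Qed.
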